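(* Let $X$ be a finite-dimensional vector space over $\mathbb{K}=\mathbb{R}$ or $\mathbb{C}$, let $N$ be a fuzzy norm on $X$, and let $(x_n)_n\subset X$ be a sequence. Then $$\lim_{n\to\infty}N(x_n,t)=1\ \text{ for all } t>0\quad\Longleftrightarrow\quad \lim_{n\to\infty}x_n=0,$$ where the limit on the right is taken in the usual topology of $X$.
   Context: A fuzzy norm on a vector space $X$ over $\mathbb{K}$ is a function $N:X\times[0,\infty)\to[0,1]$ satisfying: (N1) $N(x,0)=0$ for all $x\in X$; (N2) [$N(x,t)=1$ for all $t>0$] if and only if $x=0$; (N3) $N(\lambda x,t)=N\left(x,\frac{t}{|\lambda|}\right)$ for all $t\geq 0$, $x\in X$ and $0\neq\lambda\in\mathbb{K}$; (N4) $N(x+y,t+s)\geq\min\{N(x,t),N(y,s)\}$ for all $x,y\in X$ and $t,s\geq 0$; (N5) for each $x\in X$, $\lim_{t\to\infty}N(x,t)=1$. A pair $(X,N)$ with $N$ a fuzzy norm on $X$ is called a fuzzy normed linear space (FNLS). The usual topology of the finite-dimensional space $X$ is its unique Hausdorff vector space topology, i.e. the topology induced by any norm on $X$. *)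

(* Defs.v *)
From HB Require Import structures.
From mathcomp Require Import all_boot all_order all_algebra.
From mathcomp Require Import all_classical all_reals topology normedtype.
From mathcomp Require Import complex.

Set Implicit Arguments.
Unset Strict Implicit.
Unset Printing Implicit Defensive.

Import Order.TTheory GRing.Theory Num.Theory.
Import numFieldTopology.Exports numFieldNormedType.Exports.

Local Open Scope classical_set_scope.
Local Open Scope ring_scope.

(* The topology on M is not derived from the vectType structure: it is any
   topology making addition and scaling continuous.  For K = R or R[i], it is
   the usual topology of the finite-dimensional space M iff it is Hausdorff. *)
#[short(type="finDimTopLmodType")]
HB.structure Definition FinDimTopLmodule (K : numFieldType) :=
  {M of TopologicalLmodule K M & Vector K M}.

HB.instance Definition _ (K : numFieldType) (m n : nat) :=
  Vector.on 'M[K]_(m, n).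

(* The modulus is a parameter with values in R because the MathComp norm of
   R[i] takes its values in R[i].  N stands for a function on X * [0, +oo[: its
   values at negative t are unconstrained. *)
Record fuzzy_norm (R : realType) (K : numFieldType) (modulus : K -> R)
    (X : lmodType K) (N : X -> R -> R) : Prop := FuzzyNorm {
  fuzzy_norm_itv : forall x t, 0 <= t -> 0 <= N x t <= 1 ;
  fuzzy_norm0 : forall x, N x 0 = 0 ;
  fuzzy_norm_eq1 : forall x, (forall t, 0 < t -> N x t = 1) <-> x = 0 ;
  fuzzy_normZ : forall (a : K) x t, 0 <= t -> a != 0 ->
    N (a *: x) t = N x (t / modulus a) ;
  fuzzy_normD : forall x y t s, 0 <= t -> 0 <= s ->
    Num.min (N x t) (N y s) <= N (x + y) (t + s) ;
  fuzzy_norm_cvg : forall x, N x t @[t --> +oo] --> (1 : R)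
}.

(* Main.v *)
Require Import Defs.
From mathcomp Require Import all_boot all_order all_algebra.
From mathcomp Require Import all_classical all_reals topology normedtype.
From mathcomp Require Import complex.
Import Order.TTheory GRing.Theory Num.Theory.
Import numFieldTopology.Exports numFieldNormedType.Exports.
Import passmx.
Local Open Scope classical_set_scope.
Local Open Scope ring_scope.

(** The fuzzy norm makes [X] a Hausdorff topological vector space in its own
right: the sets [{x | 1 - e < N x e}], for [e > 0], form a base of
neighbourhoods of [0], and [N (x n) t] tends to [1] for every [t > 0] exactly
when [x n] tends to [0] for this topology.  The theorem is thus an instance of
the uniqueness of the Hausdorff vector topology of a finite-dimensional space.

Only neighbourhoods of [0] matter here, so a vector topology is represented by
its filter of neighbourhoods of [0] ([hausdorff_vector_filter]).  Both the given
topology ([nbhs0_hvf]) and the fuzzy norm ([fuzzy_filter_hvf]) provide such a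
filter, and it suffices to see that each one refines the other ([hvf_unique]).
For this both are compared with the image of the neighbourhoods of [0] under a
linear bijection [phi] from some [R^m] onto [X].

- That [phi] is continuous at [0] ([hvf_coarser]) follows by writing a vector as
  the sum of its components along the standard basis.

- That the inverse of [phi] is continuous at [0] ([hvf_finer]) is where
  compactness enters.  No [phi v] with [v] on a sphere of [R^m] is [0], so
  separation and compactness give a neighbourhood of [0] which misses the whole
  image of the sphere.  A balanced neighbourhood inside it cannot meet the
  image of the exterior of the sphere either, since scaling down a point of the
  latter would reach the sphere.

The argument uses real scalars only.  The complex case is covered by regarding
[X] as a real vector space, [R[i]^d] being [R^(d + d)] through real and imaginary
parts; this is why the scalar multiplication below is a parameter [s], equal to
[a |-> iota a *: _] with [iota] the embedding of [R] into the scalar field. *)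

(** * Neighbourhood filters of Hausdorff vector topologies *)

(** The filters of neighbourhoods of [0] for the Hausdorff topologies on [X] that
make addition and the scalar multiplication [s] continuous. *)
Record hausdorff_vector_filter {R : realType} {X : zmodType} (s : R -> X -> X)
    (F : set_system X) : Prop := HausdorffVectorFilter {
  hvf_filter : Filter F ;
  hvf_add : forall U, F U ->
    exists2 W, F W & forall x y, W x -> W y -> U (x + y) ;
  hvf_balanced : forall U, F U ->
    exists2 W, F W & forall a x, `|a| <= 1 -> W x -> U (s a x) ;
  hvf_absorbing : forall x U, F U -> \forall a \near (0 : R), U (s a x) ;
  hvf_separated : forall x, x != 0 -> exists2 U, F U & ~ U x
}.

(** * Uniqueness in finite dimension *)

Section Uniqueness.
Context {R : realType} {X : zmodType} (s : R -> X -> X) {m : nat}.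
Variable phi : 'rV[R]_m -> X.
Hypothesis phiD : forall u v, phi (u + v) = phi u + phi v.
Hypothesis phiZ : forall a u, phi (a *: u) = s a (phi u).
Hypothesis phi_inj : injective phi.
Hypothesis phi_surj : forall x, exists u, phi u = x.

Let phi0 : phi 0 = 0.
Proof. by apply: (addrI (phi 0)); rewrite -phiD !addr0. Qed.

(** Each component [v 0 j *: e_j] is small when [v] is, because [F] is absorbing,
and a neighbourhood of [0] contains the sums of [m] elements of a smaller one. *)
Lemma hvf_coarser F : hausdorff_vector_filter s F -> phi @ (0 : 'rV[R]_m) --> F.
Proof.
move=> hF U FU; rewrite nbhs_simpl /=.
suff: forall r : seq 'I_m, forall U, F U ->
    \forall v \near (0 : 'rV[R]_m),
      U (phi (\sum_(j <- r) (v : 'rV[R]_m) 0 j *: delta_mx 0 j)).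
  by move=> /(_ (index_enum 'I_m) U FU); apply: filterS => v;
    rewrite -row_sum_delta.
elim=> [|j r IHr] {FU}U FU.
  have U0 : U 0.
    have /nbhs_singleton := hvf_absorbing _ _ hF (phi 0) U FU.
    by rewrite -phiZ scaler0 phi0.
  by near=> v; rewrite big_nil phi0.
have [W FW WU] := hvf_add _ _ hF U FU.
have Wj : \forall v \near (0 : 'rV[R]_m), W (phi ((v : 'rV[R]_m) 0 j *: delta_mx 0 j)).
  have cj : (v : 'rV[R]_m) 0 j @[v --> 0] --> (0 : R).
    by have := @coord_continuous R 1 m 0 j 0; rewrite /continuous_at mxE.
  near=> v; rewrite phiZ; near: v.
  exact: cj _ (hvf_absorbing _ _ hF (phi (delta_mx 0 j)) W FW).
near=> v; rewrite big_cons phiD; apply: WU.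
  by near: v.
by near: v; exact: IHr.
Unshelve. all: by end_near. Qed.

(** Let [S] be the sphere of radius [e / 2].  The tube lemma for the compact set
[S] along the filter [F] turns the local statement, that points [w] close to [0]
differ from [phi v'] for [v'] close to a given [v] in [S], into one valid on all
of [S] at once. *)
Lemma hvf_finer F : hausdorff_vector_filter s F -> F --> phi @ (0 : 'rV[R]_m).
Proof.
move=> hF A; rewrite nbhs_simpl /= => /nbhs_ballP [e /= e0 eA].
have FF := hvf_filter _ _ hF.
pose S : set 'rV[R]_m := [set v | `|v| = e / 2].
have e20 : 0 < e / 2 by rewrite divr_gt0.
have cS : compact S.
  apply: bounded_closed_compact.
    exists (e / 2); split; first exact: num_real.
    by move=> M eM v /= ->; exact: ltW.
  have -> : S = (fun v : 'rV[R]_m => `|v|) @^-1` [set e / 2] by [].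
  apply: preimage_closed; last exact: closed_eq.
  by move=> v _; exact: norm_continuous.
have FS : \forall w \near F, S `<=` [set v | phi v <> w].
  move/compact_near_coveringP : cS => /(_ X F (fun w v => phi v <> w) FF).
  apply=> v Sv.
  have v0 : phi v != 0.
    apply/eqP; rewrite -phi0 => /phi_inj v0; move: Sv.
    by rewrite /S /= v0 normr0 => E; rewrite -E ltxx in e20.
  (* If [phi v' = w] is small, so is [phi v = phi (v - v') + w] for [v'] close to
     [v], which contradicts separation. *)
  have [U FU Uv] := hvf_separated _ _ hF _ v0.
  have [W FW WU] := hvf_add _ _ hF U FU.
  have Wnear : \forall v' \near v, W (phi (v - v')).
    have : v - v' @[v' --> v] --> (0 : 'rV[R]_m).
      rewrite -[X in _ --> X](subrr v).
      exact: (cvgB (cvg_cst _) cvg_id).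
    by move=> /(_ _ (hvf_coarser F hF W FW)).
  exists ([set v' | W (phi (v - v'))], W) => //=.
  move=> [v' w] /= [Wv' Ww] vw; apply: Uv.
  have -> : phi v = phi (v - v') + w by rewrite -vw -phiD subrK.
  exact: WU.
have [W FW WS] := hvf_balanced _ _ hF _ FS.
apply: filterS FW => x Wx; have [v vx] := phi_surj x; rewrite -vx.
apply: eA; rewrite -ball_normE /= sub0r normrN ltNge; apply/negP => ev.
(* If [e <= `|v|], then scaling [v] down to norm [e / 2] lands in [S] while
   its image stays in the balanced neighbourhood. *)
have v0 : 0 < `|v| by exact: lt_le_trans ev.
have := WS (e / 2 / `|v|) x.
rewrite normrM normfV normr_id (gtr0_norm e20) ler_pdivrMr// mul1r.
have -> : e / 2 <= `|v| by rewrite (le_trans _ ev)// ler_piMr ?invf_le1 ?ler1n// ltW.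
move=> /(_ isT Wx (e / 2 / `|v| *: v)); apply; last by rewrite phiZ vx.
rewrite /S /= normrZ normrM normfV normr_id (gtr0_norm e20).
by rewrite divfK// gt_eqF.
Qed.

Lemma hvf_unique F G : hausdorff_vector_filter s F ->
  hausdorff_vector_filter s G -> F --> G.
Proof.
move=> hF hG; exact: cvg_trans (hvf_finer F hF) (hvf_coarser G hG).
Qed.

End Uniqueness.

(** * The vector topology of a fuzzy norm *)

Section FuzzyFilter.
Context {R : realType} {K : numFieldType} (iota : {rmorphism R -> K}).
Variables (modulus : K -> R) (X : lmodType K) (N : X -> R -> R).
Hypothesis modulusE : forall a, modulus (iota a) = `|a|.
Hypothesis hN : fuzzy_norm modulus N.

(** The neighbourhoods of [0] for the topology of [N].  The usual base has two
parameters, [{x | 1 - a < N x t}]; as [N x] is nondecreasing, taking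
[a = t = e] gives the same filter. *)
Definition fuzzy_filter : set_system X :=
  filter_from [set e : R | 0 < e] (fun e => [set x | 1 - e < N x e]).

Let N1 t : 0 < t -> N 0 t = 1.
Proof. by have [_ +] := fuzzy_norm_eq1 hN 0; apply. Qed.

(** Add the zero vector, whose fuzzy norm is [1] at every positive time. *)
Lemma fuzzy_norm_ndecr x t u : 0 <= t -> t <= u -> N x t <= N x u.
Proof.
move=> t0; rewrite le_eqVlt => /predU1P[->//|tu].
have ut : 0 < u - t by rewrite subr_gt0.
have := fuzzy_normD hN x 0 t0 (ltW ut).
rewrite addr0 subrKC N1// min_l//.
by have /andP[] := fuzzy_norm_itv hN x t0.
Qed.

Lemma fuzzy_cvgP (x : nat -> X) :
  (forall t, 0 < t -> N (x n) t @[n --> \oo] --> (1 : R)) <->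
  x @ \oo --> fuzzy_filter.
Proof.
split=> [xN U [e /= e0 eU]|xN t t0].
  have /cvgrPdist_lt /(_ e e0) := xN e e0.
  apply: (@filterS _ \oo) => n /= ne; apply: eU => /=.
  by rewrite ltrBlDr addrC -ltrBlDr (le_lt_trans (ler_norm _)).
apply/cvgrPdist_lt => e e0.
have d0 : 0 < Num.min e t by rewrite lt_min e0.
have : fuzzy_filter [set y | 1 - Num.min e t < N y (Num.min e t)].
  by exists (Num.min e t).
move=> /xN; apply: (@filterS _ \oo) => n /= nd.
have /andP[_ le1] := fuzzy_norm_itv hN (x n) (ltW t0).
rewrite ger0_norm ?subr_ge0// ltrBlDr addrC -ltrBlDr.
apply: (le_lt_trans (y := 1 - Num.min e t)); first by rewrite lerB ?ge_min ?lexx.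
apply: (lt_le_trans nd); apply: fuzzy_norm_ndecr; first exact: ltW.
by rewrite ge_min lexx orbT.
Qed.

(** The min inequality for sums makes addition continuous.  Scaling by [a] divides
time by [`|a|], so that monotonicity in time gives balancedness, and the limit
[1] at infinite time gives absorption.  Separation holds because only the zero
vector has fuzzy norm [1] at every positive time. *)
Lemma fuzzy_filter_hvf :
  hausdorff_vector_filter (fun a x => iota a *: x) fuzzy_filter.
Proof.
have widen (x : X) (d e : R) : 0 < d -> d <= e -> 1 - d < N x d -> 1 - e < N x e.
  move=> d0 de Nd; apply: (le_lt_trans (y := 1 - d)); first by rewrite lerB.
  by apply: (lt_le_trans Nd); apply: fuzzy_norm_ndecr => //; exact: ltW.
have iota0 (a : R) : a != 0 -> iota a != 0 by rewrite fmorph_eq0.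
split.
- apply: filter_from_filter; first by exists 1 => /=.
  move=> d e /= d0 e0; exists (Num.min d e) => /=; first by rewrite lt_min d0.
  have m0 : 0 < Num.min d e by rewrite lt_min d0.
  by move=> x /= Nx; split; apply: widen Nx => //; rewrite ge_min lexx ?orbT.
- move=> U [e /= e0 eU].
  have e20 : 0 < e / 2 by rewrite divr_gt0.
  exists [set x | 1 - e / 2 < N x (e / 2)]; first by exists (e / 2).
  move=> x y /= Nx Ny; apply: eU => /=.
  have := fuzzy_normD hN x y (ltW e20) (ltW e20); rewrite -splitr.
  apply: lt_le_trans; apply: (lt_trans (y := 1 - e / 2)).
    by rewrite ltrD2l ltrN2 ltr_pdivrMr// ltr_pMr// ltr1n.
  by rewrite lt_min Nx.
- move=> U [e /= e0 eU]; exists [set x | 1 - e < N x e]; first by exists e.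
  move=> a x a1 /= Nx; apply: eU => /=.
  have [->|a0] := eqVneq a 0.
    by rewrite rmorph0 scale0r N1// ltrBlDr ltrDl.
  rewrite (fuzzy_normZ hN) ?iota0 ?ltW// modulusE.
  apply: (lt_le_trans Nx); apply: fuzzy_norm_ndecr; first exact: ltW.
  by rewrite ler_pdivlMr ?normr_gt0// ler_piMr// ltW.
- move=> x U [e /= e0 eU].
  have /cvgrPdist_lt /(_ e e0) [M [_ NM]] := fuzzy_norm_cvg hN x.
  have M0 : 0 < `|M| + 1 by rewrite ltr_wpDl.
  have : \forall a \near (0 : R), `|a| < e / (`|M| + 1).
    by apply/nbhs_ballP; exists (e / (`|M| + 1)); rewrite /= ?divr_gt0// => a;
      rewrite -ball_normE /= sub0r normrN.
  apply: filterS => a aM; apply: eU => /=.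
  have [->|a0] := eqVneq a 0.
    by rewrite rmorph0 scale0r N1// ltrBlDr ltrDl.
  rewrite (fuzzy_normZ hN) ?iota0 ?ltW// modulusE.
  have : `|1 - N x (e / `|a|)| < e.
    apply: NM; apply: (le_lt_trans (ler_norm M)).
    apply: (lt_trans (y := `|M| + 1)); first by rewrite ltrDl.
    by rewrite ltr_pdivlMr ?normr_gt0// mulrC -ltr_pdivlMr.
  by move=> h; rewrite ltrBlDr addrC -ltrBlDr (le_lt_trans (ler_norm _)).
- move=> x x0.
  have [t t0 Nxt] : exists2 t, 0 < t & N x t < 1.
    apply: contra_notP (elimN eqP x0) => h; apply/(fuzzy_norm_eq1 hN) => t t0.
    have /andP[_] := fuzzy_norm_itv hN x (ltW t0).
    by rewrite le_eqVlt => /predU1P[//|Nt]; case: h; exists t.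
  set e := Num.min t (1 - N x t).
  have e0 : 0 < e by rewrite lt_min t0 subr_gt0.
  exists [set y | 1 - e < N y e]; first by exists e.
  apply/negP; rewrite -leNgt; apply: (le_trans (y := N x t)).
    by apply: fuzzy_norm_ndecr; [exact: ltW | rewrite ge_min lexx].
  by rewrite lerBrDr addrC -lerBrDr ge_min lexx orbT.
Qed.

End FuzzyFilter.

(** * The given vector topology *)

Section TopologicalFilter.
Context {R : realType} {K : numFieldType} (iota : {rmorphism R -> K}).
Hypothesis iota_cont : continuous (iota : R -> K).
Variable X : topologicalLmodType K.
Hypothesis X_hausdorff : hausdorff_space X.

Let iota_cvg0 : iota a @[a --> (0 : R)] --> (0 : K).
Proof. by rewrite -[X in _ --> X](rmorph0 iota); exact: iota_cont. Qed.

Lemma nbhs0_hvf :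
  hausdorff_vector_filter (fun (a : R) (x : X) => iota a *: x) (nbhs (0 : X)).
Proof.
split.
- exact: nbhs_filter.
- move=> U; rewrite -[0 : X](addr0 0) => /(@add_continuous X (0, 0)).
  rewrite addr0 => -[[A B] /= [A0 B0] ABU].
  exists (A `&` B); first exact: filterI.
  by move=> x y [Ax _] [_ By]; apply: (ABU (x, y)).
- move=> U U0.
  have := @scale_continuous K X (0, 0) U.
  rewrite /= scaler0 => /(_ U0) [[A B] /= [A0 B0] ABU].
  (* Scalars below [e] send [B] into [U], so scalars below [1] send
     [(e / 2) B] into [U], and [(e / 2) B] is a neighbourhood of [0]. *)
  have /nbhs_ballP [e /= e0 eA] := iota_cvg0 A A0.
  have e20 : e / 2 != 0 by rewrite gt_eqF// divr_gt0.
  exists [set x | B ((iota (e / 2))^-1 *: x)].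
    have := @scale_continuous K X ((iota (e / 2))^-1, 0) B.
    rewrite /= scaler0 => /(_ B0) [[A' B'] /= [A'0 B'0] ABB].
    apply: filterS B'0 => x B'x; apply: (ABB (_, x)); split => //=.
    exact: nbhs_singleton.
  move=> a x a1 /= Bx.
  have -> : iota a *: x = iota (a * (e / 2)) *: ((iota (e / 2))^-1 *: x).
    by rewrite scalerA rmorphM mulfK// fmorph_eq0.
  apply: (ABU (_, _)); split => //=; apply: eA.
  rewrite -ball_normE /= sub0r normrN normrM (@gtr0_norm _ (e / 2)) ?divr_gt0//.
  apply: (le_lt_trans (y := e / 2)); first by rewrite ler_piMl// ltW ?divr_gt0.
  by rewrite ltr_pdivrMr// ltr_pMr// ltr1n.
- move=> x U U0.
  have := @scale_continuous K X (0, x) U.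
  rewrite /= scale0r => /(_ U0) [[A B] /= [A0 B0] ABU].
  have := iota_cvg0 A A0; apply: (@filterS _ (nbhs (0 : R))) => a /= Aa.
  by apply: (ABU (_, x)); split => //=; exact: nbhs_singleton.
- move=> x x0; rewrite eq_sym in x0.
  have [A [oA A0 Ax]] := hausdorff_accessible X_hausdorff x0.
  exists A; first by apply: open_nbhs_nbhs; split => //; exact/set_mem.
  by move/set_mem: Ax.
Qed.

End TopologicalFilter.

(** * Comparison of the two topologies *)

Lemma fuzzy_cvg_iff {R : realType} {K : numFieldType} (iota : {rmorphism R -> K})
    (modulus : K -> R) (X : topologicalLmodType K) (N : X -> R -> R) (m : nat)
    (phi : 'rV[R]_m -> X) (x : nat -> X) :
  continuous (iota : R -> K) ->
  (forall a, modulus (iota a) = `|a|) ->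
  (forall u v, phi (u + v) = phi u + phi v) ->
  (forall a u, phi (a *: u) = iota a *: phi u) ->
  bijective phi ->
  hausdorff_space X -> fuzzy_norm modulus N ->
  (forall t, 0 < t -> N (x n) t @[n --> \oo] --> (1 : R)) <->
  x n @[n --> \oo] --> (0 : X).
Proof.
move=> iota_cont modulusE phiD phiZ phi_bij hX hN.
have phi_inj := bij_inj phi_bij.
have phi_surj y : exists u, phi u = y.
  by have [psi _ psiK] := phi_bij; exists (psi y).
have hF := fuzzy_filter_hvf iota modulus X N modulusE hN.
have hG := nbhs0_hvf iota iota_cont X hX.
apply: (iff_trans (fuzzy_cvgP modulus X N hN x)); split => xF.
  apply: cvg_trans xF _.
  exact: (hvf_unique _ phi phiD phiZ phi_inj phi_surj _ _ hF hG).
apply: cvg_trans xF _.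
exact: (hvf_unique _ phi phiD phiZ phi_inj phi_surj _ _ hG hF).
Qed.

(** * Real coordinates on a complex space *)

Section RealCoordinates.
Context {R : realType}.

Lemma real_complex_continuous : continuous (real_complex R : R -> (R[i] : numFieldType)).
Proof.
move=> a; apply/cvgrPdist_lt => e; rewrite ltcE /= => /andP[/eqP ei e0].
have /cvgrPdist_lt /(_ _ e0) : b @[b --> (a : R)] --> (a : R) by exact: cvg_id.
apply: (@filterS _ (nbhs (a : R))) => b ab; rewrite -rmorphB normc_def /= expr0n addr0 sqrtr_sqr.
by rewrite ltcE /= ei eqxx.
Qed.

Context {X : vectType R[i]}.

Let e := vbasis {:X}.
Let d := \dim {:X}.

Definition of_real_coords (u : 'rV[R]_(d + d)) : X :=
  vecof e (\row_j (lsubmx u 0 j +i* rsubmx u 0 j)%C).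

Lemma of_real_coordsD u v :
  of_real_coords (u + v) = of_real_coords u + of_real_coords v.
Proof.
by rewrite /of_real_coords -linearD; congr (vecof e); apply/rowP => j; rewrite !mxE.
Qed.

Lemma of_real_coordsZ (a : R) u :
  of_real_coords (a *: u) = real_complex R a *: of_real_coords u.
Proof.
rewrite /of_real_coords -linearZ; congr (vecof e); apply/rowP => j; rewrite !mxE.
by apply/eqP; rewrite eq_complex /= !mul0r subr0 addr0 !eqxx.
Qed.

Lemma of_real_coords_bij : bijective of_real_coords.
Proof.
exists (fun x : X => row_mx (map_mx (@complex.Re R) (rVof e x)) (map_mx (@complex.Im R) (rVof e x))) => [u|x].
  rewrite /of_real_coords (vecofK (vbasisP _)) -[RHS]hsubmxK.
  by congr row_mx; apply/rowP => j; rewrite !mxE.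
rewrite /of_real_coords row_mxKl row_mxKr -[RHS](rVofK (vbasisP _)); congr (vecof e).
by apply/rowP => j; rewrite !mxE; case: (coord e j x).
Qed.

End RealCoordinates.

Theorem proposition3p8 (R : realType) :
  (forall (X : finDimTopLmodType R) (N : X -> R -> R) (x : nat -> X),
     hausdorff_space X ->
     fuzzy_norm (fun a : R => `|a|) N ->
     ((forall t : R, 0 < t -> N (x n) t @[n --> \oo] --> (1 : R)) <->
      x n @[n --> \oo] --> (0 : X)))
  /\
  (forall (X : finDimTopLmodType R[i]) (N : X -> R -> R) (x : nat -> X),
     hausdorff_space X ->
     fuzzy_norm (@Normc.normc R) N ->
     ((forall t : R, 0 < t -> N (x n) t @[n --> \oo] --> (1 : R)) <->
      x n @[n --> \oo] --> (0 : X))).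
Proof.
split=> X N x hX hN.
  apply: (@fuzzy_cvg_iff R R idfun _ X N _ (vecof (vbasis {:X})) x)
    hX hN => //.
  - by move=> a; exact: cvg_id.
  - by move=> u v; rewrite linearD.
  - by move=> a u; rewrite linearZ.
  - exists (rVof (vbasis {:X})); first exact: vecofK (vbasisP _).
    exact: rVofK (vbasisP _).
apply: (fuzzy_cvg_iff (real_complex R) _ X N _ of_real_coords x) hX hN => //.
- exact: real_complex_continuous.
- by move=> a; rewrite /Normc.normc /= expr0n addr0 sqrtr_sqr.
- exact: of_real_coordsD.
- exact: of_real_coordsZ.
- exact: of_real_coords_bij.
Qed.
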